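(* With $S_1,S_2,S_3,S_4$ as defined in the context, we have $$S_1(q)=(-q^3;q^3)_\infty\, S_3(q), \qquad S_2(q)=(-q^3;q^3)_\infty\, S_4(q).$$
   Context: Let $|q|<1$ and use standard $q$-Pochhammer notation $(a;q)_n=\prod_{k=0}^{n-1}(1-aq^k)$, $(a;q)_\infty=\prod_{k\ge0}(1-aq^k)$. Define $$S_1(q)=\sum_{i,j\geq 0}\frac{q^{\frac{1}{2}i^2-ij+2j^2-\frac{1}{2}i+2j}}{(q^3;q^3)_i(q^3;q^3)_j},\qquad S_2(q)=\sum_{i,j\geq 0}\frac{q^{\frac{1}{2}i^2-ij+2j^2+\frac{3}{2}i}}{(q^3;q^3)_i (q^3;q^3)_j},$$ $$S_3(q)=\sum_{i,j\geq 0} \frac{q^{2i^2+2ij+2j^2-2i-j}}{(q^3;q^3)_i(q^3;q^3)_j},\qquad S_4(q)=\sum_{i,j\geq 0} \frac{q^{2i^2+2ij+2j^2}}{(q^3;q^3)_i(q^3;q^3)_j}.$$ (All exponents of $q$ are integers.) *)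

(* Defs.v *)
From Stdlib Require Import Reals ZArith.
From Coquelicot Require Import Coquelicot.
Open Scope C_scope.

Definition cpowZ (q : C) (z : Z) : C :=
  if (0 <=? z)%Z then q ^ Z.to_nat z else / (q ^ Z.to_nat (- z)).

Fixpoint qpoch (a q : C) (n : nat) : C :=
  match n with
  | O => 1
  | S n' => qpoch a q n' * (1 - a * q ^ n')
  end.

Definition qpoch_inf (a q : C) : C :=
  @lim (CompleteNormedModule.CompleteSpace _ C_CompleteNormedModule) (filtermap (qpoch a q) eventually).

Definition csum (u : nat -> C) : C :=
  @lim (CompleteNormedModule.CompleteSpace _ C_CompleteNormedModule) (filtermap (sum_n u) eventually).

(* double sum sum_{i,j>=0} f i j (iterated; the series below converge
   absolutely for |q| < 1, so the order of summation is immaterial) *)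
Definition dsum (f : nat -> nat -> C) : C :=
  csum (fun i => csum (fun j => f i j)).

(* Exponents, written as integers: e.g. (1/2)i^2 - ij + 2j^2 - (1/2)i + 2j
   = (i^2 - 2ij + 4j^2 - i + 4j)/2, an exact division. *)
Definition e1 (i j : Z) : Z := ((i*i - 2*i*j + 4*j*j - i + 4*j) / 2)%Z.
Definition e2 (i j : Z) : Z := ((i*i - 2*i*j + 4*j*j + 3*i) / 2)%Z.
Definition e3 (i j : Z) : Z := (2*i*i + 2*i*j + 2*j*j - 2*i - j)%Z.
Definition e4 (i j : Z) : Z := (2*i*i + 2*i*j + 2*j*j)%Z.

Definition Sgen (e : Z -> Z -> Z) (q : C) : C :=
  dsum (fun i j => cpowZ q (e (Z.of_nat i) (Z.of_nat j))
                   / (qpoch (q^3) (q^3) i * qpoch (q^3) (q^3) j)).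

Definition S1 := Sgen e1.
Definition S2 := Sgen e2.
Definition S3 := Sgen e3.
Definition S4 := Sgen e4.

(* Main.v *)
Require Import Defs.
From Stdlib Require Import Reals ZArith Lia Lra Arith FunctionalExtensionality.
From Coquelicot Require Import Coquelicot.
Open Scope C_scope.

(* Put [p = q^3], [(p)_n = (p; p)_n] and [tri n = n (n - 1) / 2].  Insert the
   Durfee rectangle identity
     [1 / ((p)_i (p)_j) = sum_r p^((i-r)(j-r)) / ((p)_r (p)_(i-r) (p)_(j-r))]
   into the left-hand sums and write [i = r + u], [j = r + v].  The power of [q]
   becomes [q^tri(u+2v) a^u b^v p^(tri(r+1) + r v)], where [(a, b) = (1, q^3)] for
   [S1] and [(a, b) = (q^2, q)] for [S2].  By Euler, summing over [r] gives
   [(-p^(v+1); p)_oo = (-p; p)_oo / (-p; p)_v], which produces the factor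
   [(-p; p)_oo].  The remaining weight [q^tri(u+2v)] depends only on [N = u + 2v],
   and for fixed [N]
     [sum_(u+2v=N) a^u b^v / ((p)_u (p^2; p^2)_v)
      = sum_(i+2j=N) p^tri(i) a^i d^j / ((p)_i (p)_j)],
   with [d = 1], resp. [d = q]; this turns the sum into [S3], resp. [S4]. *)

(** * Complex series dominated by geometric series *)

Definition tends_to (s : nat -> C) (l : C) : Prop :=
  forall eps : R, (0 < eps)%R ->
  exists N : nat, forall n : nat, (N <= n)%nat -> (Cmod (s n - l) < eps)%R.

Lemma tends_to_filterlim (s : nat -> C) (l : C) :
  tends_to s l <->
  filterlim s eventually (locally (T := C_NormedModule) l).
Proof.
split.
- intros H.
  apply (filterlim_locally_ball_norm (U := C_NormedModule)).
  intros eps. destruct (H eps (cond_pos eps)) as [N HN].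
  exists N. intros n Hn. unfold ball_norm. apply HN, Hn.
- intros H eps He.
  pose proof (proj1 (filterlim_locally_ball_norm (U := C_NormedModule) s l) H
    (mkposreal eps He)) as [N HN].
  exists N. intros n Hn. exact (HN n Hn).
Qed.

(** The total operator [lim] only means something on Cauchy filters. A convergent sequence gives
    one, completeness then makes [lim] a limit, and limits are unique. *)
Lemma lim_tends_to (s : nat -> C) (l : C) :
  tends_to s l ->
  @lim (CompleteNormedModule.CompleteSpace _ C_CompleteNormedModule)
    (filtermap s eventually) = l.
Proof.
intros H. apply tends_to_filterlim in H.
apply (filterlim_locally_unique (V := C_NormedModule) (F := eventually) s);
  [|exact H].
assert (HF : ProperFilter (filtermap s eventually))
  by (apply filtermap_proper_filter, eventually_filter).
apply (filterlim_locally (U := C_UniformSpace)).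
apply (complete_cauchy (T := CompleteNormedModule.CompleteSpace _ C_CompleteNormedModule)
  (filtermap s eventually) HF).
intros eps. exists l.
apply (proj1 (filterlim_locally (U := C_UniformSpace) s l) H).
Qed.

Lemma tends_to_squeeze (s : nat -> C) (l : C) (M rho : R) :
  (0 <= rho < 1)%R ->
  (forall n, (Cmod (s n - l) <= M * rho ^ n)%R) -> tends_to s l.
Proof.
intros Hr H eps He.
assert (HM : (0 <= M)%R).
{ specialize (H O). simpl in H. pose proof (Cmod_ge_0 (s O - l)). lra. }
(* The denominator is [M + 1] because [M] may be 0. *)
destruct (pow_lt_1_zero rho ltac:(rewrite Rabs_pos_eq; lra) (eps / (M + 1)))
  as [N HN].
{ apply Rdiv_lt_0_compat; lra. }
exists N. intros n Hn. specialize (HN n Hn).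
rewrite Rabs_pos_eq in HN by (apply pow_le; lra).
eapply Rle_lt_trans; [apply H|].
apply Rmult_lt_compat_r with (r := (M + 1)%R) in HN; [|lra].
unfold Rdiv in HN. rewrite Rmult_assoc, Rinv_l, Rmult_1_r in HN by lra.
pose proof (pow_le rho n ltac:(lra)). nra.
Qed.

(** The index [n] is excluded, unlike in [sum_n], so that the empty sum is available. *)
Fixpoint psum (u : nat -> C) (n : nat) : C :=
  match n with
  | O => 0
  | S n' => psum u n' + u n'
  end.

Lemma sum_n_psum (u : nat -> C) (n : nat) : sum_n u n = psum u (S n).
Proof.
induction n as [|n IH].
- rewrite sum_O. simpl. ring.
- rewrite sum_Sn, IH. reflexivity.
Qed.

Lemma psum_ext (u v : nat -> C) (n : nat) :
  (forall k, (k < n)%nat -> u k = v k) -> psum u n = psum v n.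
Proof.
induction n as [|n IH]; intros H; simpl; [reflexivity|].
rewrite IH, H by auto. reflexivity.
Qed.

Lemma psum_plus (u v : nat -> C) (n : nat) :
  psum (fun k => u k + v k) n = psum u n + psum v n.
Proof. induction n as [|n IH]; simpl; [ring|rewrite IH; ring]. Qed.

Lemma psum_scal (c : C) (u : nat -> C) (n : nat) :
  psum (fun k => c * u k) n = c * psum u n.
Proof. induction n as [|n IH]; simpl; [ring|rewrite IH; ring]. Qed.

Lemma psum_head (u : nat -> C) (n : nat) :
  psum u (S n) = u O + psum (fun k => u (S k)) n.
Proof.
induction n as [|n IH]; [simpl; ring|].
change (psum u (S (S n))) with (psum u (S n) + u (S n)).
rewrite IH. simpl. ring.
Qed.

Lemma tends_to_psum_csum (u : nat -> C) (l : C) :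
  tends_to (psum u) l -> csum u = l.
Proof.
intros H. apply lim_tends_to. intros eps He.
destruct (H eps He) as [N HN]. exists N. intros n Hn.
rewrite sum_n_psum. apply HN. lia.
Qed.

Definition geo_dom (M : R) (u : nat -> C) : Prop :=
  forall n, (Cmod (u n) <= M * (/2)^n)%R.

Lemma geo_dom_nonneg (M : R) (u : nat -> C) : geo_dom M u -> (0 <= M)%R.
Proof. intros H. specialize (H O). simpl in H. pose proof (Cmod_ge_0 (u O)). lra. Qed.

Lemma csum_correct (M : R) (u : nat -> C) :
  geo_dom M u -> tends_to (psum u) (csum u).
Proof.
intros H.
destruct (ex_series_le (V := C_CompleteNormedModule) u (fun n => M * (/2)^n)%R)
  as [l Hl].
- exact H.
- apply (ex_series_scal_l M (fun n => (/2)^n)%R).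
  exists (/ (1 - /2))%R. apply is_series_geom. rewrite Rabs_pos_eq; lra.
- assert (T : tends_to (sum_n u) l) by (apply tends_to_filterlim; exact Hl).
  assert (T' : tends_to (psum u) l).
  { intros eps He. destruct (T eps He) as [N HN]. exists (S N).
    intros n Hn. destruct n as [|n]; [lia|]. rewrite <- sum_n_psum.
    apply HN. lia. }
  rewrite (tends_to_psum_csum u l T'). exact T'.
Qed.

Lemma csum_ext (u v : nat -> C) : (forall n, u n = v n) -> csum u = csum v.
Proof. intros H. f_equal. apply functional_extensionality, H. Qed.

(** The right-hand side is the exact value of the geometric block, which lets the induction on [m]
    close. *)
Lemma psum_geo_bound (M : R) (u : nat -> C) (n m : nat) :
  geo_dom M u ->
  (Cmod (psum u (n + m) - psum u n) <= 2 * M * (/2)^n - 2 * M * (/2)^(n + m))%R.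
Proof.
intros H. induction m as [|m IH].
- rewrite Nat.add_0_r. replace (psum u n - psum u n) with (RtoC 0) by ring.
  rewrite Cmod_0. lra.
- rewrite Nat.add_succ_r. simpl psum.
  replace (psum u (n + m) + u (n + m)%nat - psum u n)
    with ((psum u (n + m) - psum u n) + u (n + m)%nat) by ring.
  eapply Rle_trans; [apply Cmod_triangle|].
  specialize (H (n + m)%nat). simpl pow. lra.
Qed.

Lemma tends_to_Cmod_le (s : nat -> C) (l c : C) (B : R) (N : nat) :
  tends_to s l -> (forall n, (N <= n)%nat -> (Cmod (s n - c) <= B)%R) ->
  (Cmod (l - c) <= B)%R.
Proof.
intros H HB. apply Rnot_lt_le. intros Hlt.
destruct (H (Cmod (l - c) - B)%R ltac:(lra)) as [N' HN].
specialize (HN (N + N')%nat ltac:(lia)). specialize (HB (N + N')%nat ltac:(lia)).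
pose proof (Cmod_triangle (l - s (N + N')%nat) (s (N + N')%nat - c)) as T.
replace (l - s (N + N')%nat + (s (N + N')%nat - c)) with (l - c) in T by ring.
rewrite <- (Cmod_opp (l - s (N + N')%nat)) in T.
replace (- (l - s (N + N')%nat)) with (s (N + N')%nat - l) in T by ring.
lra.
Qed.

Lemma csum_tail (M : R) (u : nat -> C) (n : nat) :
  geo_dom M u -> (Cmod (csum u - psum u n) <= 2 * M * (/2)^n)%R.
Proof.
intros H. pose proof (geo_dom_nonneg M u H) as HM.
apply (tends_to_Cmod_le (psum u) _ _ _ n (csum_correct M u H)).
intros k Hk. replace k with (n + (k - n))%nat by lia.
eapply Rle_trans; [apply psum_geo_bound, H|].
pose proof (pow_lt (/2) (n + (k - n)) ltac:(lra)). nra.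
Qed.

Lemma csum_bound (M : R) (u : nat -> C) :
  geo_dom M u -> (Cmod (csum u) <= 2 * M)%R.
Proof.
intros H. pose proof (csum_tail M u 0 H) as T. simpl in T.
replace (csum u - 0) with (csum u) in T by ring. lra.
Qed.

Lemma tends_to_plus (s t : nat -> C) (l m : C) :
  tends_to s l -> tends_to t m -> tends_to (fun n => s n + t n) (l + m).
Proof.
intros H1 H2 eps He.
destruct (H1 (eps / 2)%R ltac:(lra)) as [N1 HN1].
destruct (H2 (eps / 2)%R ltac:(lra)) as [N2 HN2].
exists (N1 + N2)%nat. intros n Hn.
specialize (HN1 n ltac:(lia)). specialize (HN2 n ltac:(lia)).
replace (s n + t n - (l + m)) with ((s n - l) + (t n - m)) by ring.
eapply Rle_lt_trans; [apply Cmod_triangle|lra].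
Qed.

Lemma tends_to_scal (c : C) (s : nat -> C) (l : C) :
  tends_to s l -> tends_to (fun n => c * s n) (c * l).
Proof.
intros H eps He. pose proof (Cmod_ge_0 c) as Hc.
destruct (H (eps / (Cmod c + 1))%R) as [N HN].
{ apply Rdiv_lt_0_compat; lra. }
exists N. intros n Hn. specialize (HN n Hn).
replace (c * s n - c * l) with (c * (s n - l)) by ring. rewrite Cmod_mult.
apply Rmult_lt_compat_r with (r := (Cmod c + 1)%R) in HN; [|lra].
unfold Rdiv in HN. rewrite Rmult_assoc, Rinv_l, Rmult_1_r in HN by lra.
pose proof (Cmod_ge_0 (s n - l)). nra.
Qed.

Lemma tends_to_ext (s t : nat -> C) (l : C) :
  (forall n, s n = t n) -> tends_to s l -> tends_to t l.
Proof.
intros E H eps He. destruct (H eps He) as [N HN]. exists N. intros n Hn.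
rewrite <- E. auto.
Qed.

Lemma csum_plus (M1 M2 : R) (u v : nat -> C) :
  geo_dom M1 u -> geo_dom M2 v -> csum (fun n => u n + v n) = csum u + csum v.
Proof.
intros H1 H2. apply tends_to_psum_csum.
eapply tends_to_ext; [intros n; symmetry; apply psum_plus|].
apply tends_to_plus; eapply csum_correct; eassumption.
Qed.

Lemma csum_scal (M : R) (c : C) (u : nat -> C) :
  geo_dom M u -> csum (fun n => c * u n) = c * csum u.
Proof.
intros H. apply tends_to_psum_csum.
eapply tends_to_ext; [intros n; symmetry; apply psum_scal|].
apply tends_to_scal; eapply csum_correct; eassumption.
Qed.

Lemma csum_head (M : R) (u : nat -> C) :
  geo_dom M u -> csum u = u O + csum (fun n => u (S n)).
Proof.
intros H.
assert (H' : geo_dom M (fun n => u (S n))).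
{ intros n. pose proof (geo_dom_nonneg M u H). specialize (H (S n)). simpl in H.
  pose proof (pow_lt (/2) n ltac:(lra)). nra. }
apply tends_to_psum_csum. intros eps He.
destruct (csum_correct M _ H' eps He) as [N HN]. exists (S N).
intros n Hn. destruct n as [|n]; [lia|]. rewrite psum_head.
replace (u O + psum (fun k => u (S k)) n - (u O + csum (fun n => u (S n))))
  with (psum (fun k => u (S k)) n - csum (fun n => u (S n))) by ring.
apply HN. lia.
Qed.

Lemma csum_finite (u : nat -> C) (N : nat) :
  (forall n, (N <= n)%nat -> u n = 0) -> csum u = psum u N.
Proof.
intros H. apply tends_to_psum_csum. intros eps He. exists N.
intros n Hn. replace n with (N + (n - N))%nat by lia.
assert (E : forall m, psum u (N + m) = psum u N).
{ induction m as [|m IH]; [rewrite Nat.add_0_r; reflexivity|].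
  rewrite Nat.add_succ_r. simpl. rewrite IH, H by lia. ring. }
rewrite E. replace (psum u N - psum u N) with (RtoC 0) by ring.
rewrite Cmod_0. exact He.
Qed.

(** Multiplication of a generating function by [w^k]. The value 0 below [k] allows constrained sums
    to run over all indices. *)
Definition shift (k : nat) (u : nat -> C) (n : nat) : C :=
  if (k <=? n)%nat then u (n - k)%nat else 0.

Lemma shift_lt (k : nat) (u : nat -> C) (n : nat) : (n < k)%nat -> shift k u n = 0.
Proof. intros H. unfold shift. destruct (Nat.leb_spec k n); [lia|reflexivity]. Qed.

Lemma shift_add (k : nat) (u : nat -> C) (n : nat) : shift k u (k + n) = u n.
Proof.
unfold shift. destruct (Nat.leb_spec k (k + n)); [|lia]. f_equal. lia.
Qed.

Lemma psum_shift (k : nat) (u : nat -> C) (n : nat) :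
  psum (shift k u) (k + n) = psum u n.
Proof.
induction n as [|n IH].
- rewrite Nat.add_0_r. transitivity (psum (fun _ => 0) k).
  + apply psum_ext. intros. apply shift_lt. assumption.
  + simpl. induction k as [|k IH]; simpl; [reflexivity|rewrite IH; ring].
- rewrite Nat.add_succ_r. simpl. rewrite IH, shift_add. reflexivity.
Qed.

Lemma csum_shift (M : R) (k : nat) (u : nat -> C) :
  geo_dom M u -> csum (shift k u) = csum u.
Proof.
intros H. apply tends_to_psum_csum. intros eps He.
destruct (csum_correct M u H eps He) as [N HN]. exists (k + N)%nat.
intros n Hn. replace n with (k + (n - k))%nat by lia. rewrite psum_shift.
apply HN. lia.
Qed.

Definition geo_dom2 (M : R) (f : nat -> nat -> C) : Prop :=
  forall i j, (Cmod (f i j) <= M * (/2)^i * (/2)^j)%R.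

Lemma geo_dom2_row (M : R) (f : nat -> nat -> C) (i : nat) :
  geo_dom2 M f -> geo_dom (M * (/2)^i) (f i).
Proof. intros H j. apply H. Qed.

Lemma geo_dom2_swap (M : R) (f : nat -> nat -> C) :
  geo_dom2 M f -> geo_dom2 M (fun j i => f i j).
Proof. intros H j i. specialize (H i j). nra. Qed.

Lemma geo_dom2_csum (M : R) (f : nat -> nat -> C) :
  geo_dom2 M f -> geo_dom (2 * M) (fun i => csum (f i)).
Proof.
intros H i. eapply Rle_trans; [apply csum_bound, geo_dom2_row, H|lra].
Qed.

Lemma psum_csum (M : R) (f : nat -> nat -> C) (n : nat) :
  geo_dom2 M f ->
  psum (fun i => csum (f i)) n = csum (fun j => psum (fun i => f i j) n).
Proof.
intros H.
assert (HM : (0 <= M)%R) 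
  by (pose proof (geo_dom_nonneg _ _ (geo_dom2_row M f 0 H)) as T; simpl in T; lra).
induction n as [|n IH]; simpl.
- symmetry. apply (csum_finite (fun _ => 0) 0). reflexivity.
- rewrite IH. symmetry.
  apply (csum_plus (2 * M) (M * (/2)^n)).
  + intros j.
    pose proof (psum_geo_bound (M * (/2)^j) (fun i => f i j) 0 n
      (geo_dom2_row M _ j (geo_dom2_swap M f H))) as T. simpl in T.
    replace (psum (fun i => f i j) n - 0) with (psum (fun i => f i j) n) in T by ring.
    pose proof (pow_lt (/2) n ltac:(lra)). pose proof (pow_lt (/2) j ltac:(lra)).
    assert (0 <= 2 * (M * (/2)^j) * (/2)^n)%R.
    { repeat apply Rmult_le_pos; lra. }
    lra.
  + apply geo_dom2_row, H.
Qed.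

(** Finite sums pass through [csum], so the first [n] rows add up to the sum of the column partial
    sums. The error is the sum of the column tails; the tail of column [j] is at most
    [2 M 2^-n 2^-j], which gives [4 M 2^-n] in total. *)
Lemma csum_swap (M : R) (f : nat -> nat -> C) :
  geo_dom2 M f ->
  csum (fun i => csum (fun j => f i j)) = csum (fun j => csum (fun i => f i j)).
Proof.
intros H.
apply tends_to_psum_csum, (tends_to_squeeze _ _ (4 * M) (/2)); [lra|]. intros n.
change (fun i => csum (fun j => f i j)) with (fun i => csum (f i)).
rewrite (psum_csum M f n H).
pose proof (geo_dom2_swap M f H) as H'.
(* [d j] is minus the tail of column [j]. *)
set (d := fun j => -(1) * (csum (fun i => f i j) - psum (fun i => f i j) n)).
assert (Hd : geo_dom (2 * M * (/2)^n) d).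
{ intros j. unfold d. rewrite Cmod_mult, Cmod_m1, Rmult_1_l.
  eapply Rle_trans; [apply (csum_tail (M * (/2)^j)), (geo_dom2_row M _ j H')|]. lra. }
replace (csum (fun j => psum (fun i => f i j) n))
  with (csum (fun j => csum (fun i => f i j)) + csum d).
- replace (csum (fun j => csum (fun i => f i j)) + csum d
    - csum (fun j => csum (fun i => f i j))) with (csum d) by ring.
  eapply Rle_trans; [apply (csum_bound _ _ Hd)|lra].
- rewrite <- (csum_plus (2 * M) (2 * M * (/2)^n) _ d); [|apply (geo_dom2_csum M), H'|exact Hd].
  apply csum_ext. intros j. unfold d. ring.
Qed.

Definition geo_dom3 (M : R) (f : nat -> nat -> nat -> C) : Prop :=
  forall i j k, (Cmod (f i j k) <= M * (/2)^i * (/2)^j * (/2)^k)%R.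

Lemma geo_dom3_csum (M : R) (f : nat -> nat -> nat -> C) :
  geo_dom3 M f -> geo_dom2 (2 * M) (fun i j => csum (f i j)).
Proof.
intros H i j.
eapply Rle_trans; [apply (csum_bound (M * (/2)^i * (/2)^j)); intros k; apply H|lra].
Qed.

Lemma csum_rotate (M : R) (f : nat -> nat -> nat -> C) :
  geo_dom3 M f ->
  csum (fun i => csum (fun j => csum (fun k => f i j k))) =
  csum (fun k => csum (fun i => csum (fun j => f i j k))).
Proof.
intros H.
transitivity (csum (fun i => csum (fun k => csum (fun j => f i j k)))).
- apply csum_ext. intros i. apply (csum_swap (M * (/2)^i)). intros j k. apply H.
- apply (csum_swap (2 * M) (fun i k => csum (fun j => f i j k))).
  apply (geo_dom3_csum M (fun i k j => f i j k)).
  intros i k j. specialize (H i j k). nra.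
Qed.

(** * Reciprocal q-factorials *)

Definition iqfac (p : C) (n : nat) : C := / qpoch p p n.

Lemma one_sub_neq0 (x : C) : (Cmod x < 1)%R -> 1 - x <> 0.
Proof.
intros Hx E. replace x with (1 - (1 - x)) in Hx by ring.
rewrite E in Hx. replace (1 - 0) with (RtoC 1) in Hx by ring.
rewrite Cmod_1 in Hx. lra.
Qed.

Lemma Cmod_mult_pow_lt1 (a p : C) (n : nat) :
  (Cmod a < 1)%R -> (Cmod p < 1)%R -> (Cmod (a * p ^ n) < 1)%R.
Proof.
intros Ha Hp. rewrite Cmod_mult, Cmod_pow.
pose proof (Cmod_ge_0 a). pose proof (Cmod_ge_0 p).
pose proof (pow_incr (Cmod p) 1 n ltac:(lra)) as T. rewrite pow1 in T.
pose proof (pow_le (Cmod p) n ltac:(lra)). nra.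
Qed.

Lemma qpoch_neq0 (a p : C) (n : nat) :
  (Cmod a < 1)%R -> (Cmod p < 1)%R -> qpoch a p n <> 0.
Proof.
intros Ha Hp. induction n as [|n IH]; simpl.
- intros E. apply (f_equal Cmod) in E. rewrite Cmod_1, Cmod_0 in E. lra.
- apply Cmult_neq_0; [exact IH|].
  apply one_sub_neq0, Cmod_mult_pow_lt1; assumption.
Qed.

Lemma one_sub_pow_neq0 (p : C) (n : nat) : (Cmod p < 1)%R -> 1 - p ^ S n <> 0.
Proof. intros Hp. apply one_sub_neq0, (Cmod_mult_pow_lt1 p p n Hp Hp). Qed.

Lemma iqfac_0 (p : C) : iqfac p 0 = 1.
Proof. unfold iqfac. simpl. field. Qed.

Lemma iqfac_S (p : C) (n : nat) :
  (Cmod p < 1)%R -> (1 - p ^ S n) * iqfac p (S n) = iqfac p n.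
Proof.
intros Hp. unfold iqfac. change (qpoch p p (S n)) with (qpoch p p n * (1 - p ^ S n)). field.
split; [apply qpoch_neq0; exact Hp|apply one_sub_pow_neq0, Hp].
Qed.

(** * Durfee rectangles *)

(** [shift] makes the last factor vanish for [r > j], where [j - r] would be truncated. Hence
    summing over [r <= i] amounts to summing over [r <= min(i, j)]. *)
Definition durfee_term (p : C) (i j r : nat) : C :=
  p ^ ((i - r) * (j - r)) * iqfac p r * iqfac p (i - r) * shift r (iqfac p) j.

Lemma shift_iqfac_succ (p : C) (r j : nat) :
  (Cmod p < 1)%R ->
  (1 - p ^ (j - r)) * shift r (iqfac p) j = shift (S r) (iqfac p) j.
Proof.
intros Hp. unfold shift.
destruct (Nat.leb_spec r j) as [H|H], (Nat.leb_spec (S r) j) as [H'|H'];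
  try lia; try ring.
- replace (j - r)%nat with (S (j - S r)) by lia. apply iqfac_S, Hp.
- replace (j - r)%nat with O by lia. simpl. ring.
Qed.

(** Split [1 - p^(i+1) = (1 - p^(i+1-r)) + p^(i+1-r) (1 - p^r)] on the term of index [r]. The second
    piece is [y r], and the first is the term of row [i] minus [y (r+1)], so the corrections
    telescope. *)
Lemma durfee_step (p : C) (i j : nat) :
  (Cmod p < 1)%R ->
  (1 - p ^ S i) * psum (durfee_term p (S i) j) (S (S i))
  = psum (durfee_term p i j) (S i).
Proof.
intros Hp.
set (y := fun r => match r with O => RtoC 0 | S r' =>
  p ^ ((i - r') * (j - r')) * iqfac p r' * iqfac p (i - r') * shift (S r') (iqfac p) j end).
assert (Y : forall r, (r <= S i)%nat ->
  p ^ (S i - r) * (1 - p ^ r) * durfee_term p (S i) j r = y r).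
{ intros [|r] Hr; unfold y.
  - simpl. ring.
  - unfold durfee_term. replace (S i - S r)%nat with (i - r)%nat by lia.
    destruct (Nat.le_gt_cases (S r) j) as [H|H].
    + rewrite <- (iqfac_S p r Hp).
      replace ((i - r) * (j - r))%nat with ((i - r) + (i - r) * (j - S r))%nat.
      * rewrite Cpow_add_r. ring.
      * replace (j - r)%nat with (S (j - S r)) by lia. lia.
    + rewrite shift_lt by lia. ring. }
assert (X : forall r, (r <= i)%nat ->
  (1 - p ^ (S i - r)) * durfee_term p (S i) j r = durfee_term p i j r - y (S r)).
{ intros r Hr. unfold y, durfee_term. rewrite <- (shift_iqfac_succ p r j Hp).
  replace (S i - r)%nat with (S (i - r)) by lia.
  rewrite <- (iqfac_S p (i - r) Hp).
  replace (S (i - r) * (j - r))%nat with ((j - r) + (i - r) * (j - r))%nat by lia.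
  rewrite Cpow_add_r. ring. }
assert (Z : forall r, (r <= S i)%nat -> p ^ S i = p ^ (S i - r) * p ^ r).
{ intros r Hr. rewrite <- Cpow_add_r. f_equal. lia. }
assert (T : forall n, (n <= S i)%nat ->
  (1 - p ^ S i) * psum (durfee_term p (S i) j) n = psum (durfee_term p i j) n - y n).
{ induction n as [|n IH]; intros Hn; [simpl; ring|].
  change (psum (durfee_term p (S i) j) (S n))
    with (psum (durfee_term p (S i) j) n + durfee_term p (S i) j n).
  rewrite Cmult_plus_distr_l, IH by lia.
  change (psum (durfee_term p i j) (S n))
    with (psum (durfee_term p i j) n + durfee_term p i j n).
  rewrite <- (Y n) by lia.
  replace (durfee_term p i j n) with
    ((1 - p ^ (S i - n)) * durfee_term p (S i) j n + y (S n)) by (rewrite X by lia; ring).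
  rewrite (Z n) by lia. ring. }
(* For the last index [r = i+1] the first piece is zero, and [y (i+1)] cancels what the telescoping
   left over. *)
change (psum (durfee_term p (S i) j) (S (S i)))
  with (psum (durfee_term p (S i) j) (S i) + durfee_term p (S i) j (S i)).
rewrite Cmult_plus_distr_l, T by lia. rewrite <- (Y (S i)) by lia.
rewrite Nat.sub_diag. simpl (p ^ 0). ring.
Qed.

Lemma durfee_rectangle (p : C) (i j : nat) :
  (Cmod p < 1)%R -> psum (durfee_term p i j) (S i) = iqfac p i * iqfac p j.
Proof.
intros Hp. induction i as [|i IH].
- unfold durfee_term. cbn [psum Nat.sub Nat.mul Cpow].
  rewrite iqfac_0. unfold shift. cbn [Nat.leb]. rewrite Nat.sub_0_r. ring.
- pose proof (one_sub_pow_neq0 p i Hp) as H.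
  rewrite <- (iqfac_S p i Hp), <- durfee_step in IH by exact Hp.
  rewrite <- Cmult_assoc in IH.
  apply (f_equal (Cmult (/ (1 - p ^ S i)))) in IH.
  rewrite !Cmult_assoc, Cinv_l, !Cmult_1_l in IH by exact H. exact IH.
Qed.

(* [sum_(u + 2 v = N) f u * g v] *)
Definition conv2 (f g : nat -> C) (N : nat) : C :=
  psum (fun v => shift (2 * v) f N * g v) (S N).

(** * Generating-function rules for [conv2] *)

Lemma shift_shift (j k : nat) (u : nat -> C) (n : nat) :
  shift j (shift k u) n = shift (j + k) u n.
Proof.
unfold shift.
destruct (Nat.leb_spec j n), (Nat.leb_spec k (n - j)), (Nat.leb_spec (j + k) n);
  try lia; try reflexivity. f_equal. lia.
Qed.

Lemma shift_lin (c d : C) (k : nat) (u v : nat -> C) (n : nat) :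
  shift k (fun m => c * u m + d * v m) n = c * shift k u n + d * shift k v n.
Proof. unfold shift. destruct (k <=? n)%nat; cbv beta; ring. Qed.

(** Terms with [v > N] vanish because then [2 v > N]. The longer range is what the two shift rules
    need after a change of [N]. *)
Lemma conv2_bound (f g : nat -> C) (N K : nat) :
  (S N <= K)%nat -> psum (fun v => shift (2 * v) f N * g v) K = conv2 f g N.
Proof.
intros H. unfold conv2. replace K with (S N + (K - S N))%nat by lia.
induction (K - S N)%nat as [|m IH]; [rewrite Nat.add_0_r; reflexivity|].
rewrite Nat.add_succ_r. cbn [psum]. rewrite IH. rewrite shift_lt by lia. rewrite Cmult_0_l, Cplus_0_r. reflexivity.
Qed.

Lemma conv2_lin_l (c d : C) (f f' g : nat -> C) (N : nat) :
  conv2 (fun n => c * f n + d * f' n) g N = c * conv2 f g N + d * conv2 f' g N.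
Proof.
unfold conv2. rewrite <- !psum_scal, <- psum_plus. apply psum_ext.
intros k _. rewrite shift_lin. ring.
Qed.

Lemma conv2_lin_r (c d : C) (f g g' : nat -> C) (N : nat) :
  conv2 f (fun n => c * g n + d * g' n) N = c * conv2 f g N + d * conv2 f g' N.
Proof.
unfold conv2. rewrite <- !psum_scal, <- psum_plus. apply psum_ext.
intros k _. ring.
Qed.

(** [conv2 f g] lists the coefficients of [F(w) G(w^2)], so a factor [w] of [F] comes out as [w],
    and in [conv2_shift_r] a factor of [G] comes out as [w^2]. *)
Lemma conv2_shift_l (f g : nat -> C) (N : nat) :
  conv2 (shift 1 f) g N = shift 1 (conv2 f g) N.
Proof.
transitivity (psum (fun v => shift (1 + 2 * v) f N * g v) (S N)).
{ apply psum_ext. intros k _. rewrite shift_shift, Nat.add_comm. reflexivity. }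
destruct N as [|N].
- cbn [psum]. rewrite !shift_lt by lia. ring.
- change (S N) with (1 + N)%nat at 3. rewrite shift_add.
  rewrite <- (conv2_bound f g N (S (S N))) by lia.
  apply psum_ext. intros k _. rewrite <- shift_shift.
  change (S N) with (1 + N)%nat. rewrite shift_add. reflexivity.
Qed.

Lemma conv2_shift_r (f g : nat -> C) (N : nat) :
  conv2 f (shift 1 g) N = shift 2 (conv2 f g) N.
Proof.
unfold conv2 at 1. rewrite psum_head.
rewrite (shift_lt 1 g 0) by lia. rewrite Cmult_0_r, Cplus_0_l.
transitivity (psum (fun v => shift (2 + 2 * v) f N * g v) N).
{ apply psum_ext. intros k _. change (S k) with (1 + k)%nat at 2.
  rewrite shift_add. do 2 f_equal. lia. }
destruct N as [|[|N]].
- reflexivity.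
- cbn [psum]. rewrite !shift_lt by lia. ring.
- change (S (S N)) with (2 + N)%nat at 3. rewrite shift_add.
  rewrite <- (conv2_bound f g N (S (S N))) by lia.
  apply psum_ext. intros k _. rewrite <- shift_shift.
  change (S (S N)) with (2 + N)%nat. rewrite shift_add. reflexivity.
Qed.

(** The substitution of [p w] for [w] in [F(w) G(w^2)]. *)
Lemma conv2_weight (p : C) (f g : nat -> C) (N : nat) :
  conv2 (fun n => p ^ n * f n) (fun n => p ^ (2 * n) * g n) N = p ^ N * conv2 f g N.
Proof.
unfold conv2. rewrite <- psum_scal. apply psum_ext. intros k _.
unfold shift. destruct (Nat.leb_spec (2 * k) N) as [H|H]; [|ring].
replace (p ^ N) with (p ^ (N - 2 * k) * p ^ (2 * k)).
- ring.
- rewrite <- Cpow_add_r. f_equal. lia.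
Qed.

Lemma conv2_ext (f f' g g' : nat -> C) (N : nat) :
  (forall n, f n = f' n) -> (forall n, g n = g' n) -> conv2 f g N = conv2 f' g' N.
Proof.
intros E1 E2. replace f' with f by (apply functional_extensionality, E1).
replace g' with g by (apply functional_extensionality, E2). reflexivity.
Qed.

(** * The finite identity for fixed [u + 2 v = N] *)

Fixpoint tri (n : nat) : nat :=
  match n with
  | O => O
  | S n' => n' + tri n'
  end.

(** This is [1 / (p^2; p^2)_n], factored so that [1 / (-p; p)_n] from Euler's sum can be absorbed
    directly. *)
Definition iqfac2 (p : C) (n : nat) : C := / (qpoch p p n * qpoch (- p) p n).

Lemma iqfac2_S (p : C) (n : nat) :
  (Cmod p < 1)%R -> (1 - p ^ (2 * S n)) * iqfac2 p (S n) = iqfac2 p n.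
Proof.
intros Hp.
assert (Hm : (Cmod (- p) < 1)%R) by (rewrite Cmod_opp; exact Hp).
replace (1 - p ^ (2 * S n)) with ((1 - p * p ^ n) * (1 - - p * p ^ n)).
- unfold iqfac2. simpl. field. repeat split.
  + apply qpoch_neq0; assumption.
  + apply qpoch_neq0; assumption.
  + apply one_sub_neq0, Cmod_mult_pow_lt1; assumption.
  + apply one_sub_neq0, Cmod_mult_pow_lt1; assumption.
- replace (2 * S n)%nat with (S n + S n)%nat by lia. rewrite Cpow_add_r, Cpow_S. ring.
Qed.

(** Coefficient form of the functional equation [X(p w) = (1 - a w) (1 - b w^2) X(w)]. *)
Definition satisfies_rec (p a b : C) (X : nat -> C) : Prop :=
  forall N, (1 - p ^ N) * X N =
    a * shift 1 X N + b * shift 2 X N - a * b * shift 3 X N.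

Lemma shift_ext (k : nat) (u v : nat -> C) (n : nat) :
  (k <= n -> u (n - k)%nat = v (n - k)%nat)%nat -> shift k u n = shift k v n.
Proof. intros H. unfold shift. destruct (Nat.leb_spec k n); auto. Qed.

(** For [N > 0] the factor [1 - p^N] is nonzero, so the recurrence determines [X N] from earlier
    values; at [N = 0] it leaves the value free. *)
Lemma satisfies_rec_unique (p a b : C) (X Y : nat -> C) :
  (Cmod p < 1)%R -> satisfies_rec p a b X -> satisfies_rec p a b Y ->
  X O = Y O -> forall N, X N = Y N.
Proof.
intros Hp HX HY H0 N. induction N as [N IH] using lt_wf_ind.
destruct N as [|N]; [exact H0|].
assert (E : (1 - p ^ S N) * X (S N) = (1 - p ^ S N) * Y (S N)).
{ rewrite HX, HY.
  rewrite (shift_ext 1 X Y), (shift_ext 2 X Y), (shift_ext 3 X Y);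
    try reflexivity; intros; apply IH; lia. }
pose proof (one_sub_pow_neq0 p N Hp) as H.
apply (f_equal (Cmult (/ (1 - p ^ S N)))) in E.
rewrite !Cmult_assoc, Cinv_l, !Cmult_1_l in E by exact H. exact E.
Qed.

(** Coefficients of [F(p w) = (1 - a w) F(w)] for [F(w) = 1 / (a w; p)_oo]. *)
Lemma pow_weight_iqfac (p a : C) (n : nat) :
  (Cmod p < 1)%R ->
  p ^ n * (a ^ n * iqfac p n) =
  1 * (a ^ n * iqfac p n) + - a * shift 1 (fun m => a ^ m * iqfac p m) n.
Proof.
intros Hp. destruct n as [|n].
- rewrite shift_lt by lia. simpl. ring.
- change (shift 1 (fun m => a ^ m * iqfac p m) (S n))
    with (shift 1 (fun m => a ^ m * iqfac p m) (1 + n)).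
  rewrite shift_add, <- (iqfac_S p n Hp), !Cpow_S. ring.
Qed.

(** Coefficients of [G(p^2 w) = (1 - b w) G(w)] for [G(w) = 1 / (b w; p^2)_oo]. *)
Lemma pow_weight_iqfac2 (p b : C) (n : nat) :
  (Cmod p < 1)%R ->
  p ^ (2 * n) * (b ^ n * iqfac2 p n) =
  1 * (b ^ n * iqfac2 p n) + - b * shift 1 (fun m => b ^ m * iqfac2 p m) n.
Proof.
intros Hp. destruct n as [|n].
- rewrite shift_lt by lia. simpl. ring.
- change (shift 1 (fun m => b ^ m * iqfac2 p m) (S n))
    with (shift 1 (fun m => b ^ m * iqfac2 p m) (1 + n)).
  rewrite shift_add, <- (iqfac2_S p n Hp), (Cpow_S b). ring.
Qed.

(** Multiply the two preceding functional equations, the second one taken at [w^2]. *)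
Lemma satisfies_rec_bosonic (p a b : C) :
  (Cmod p < 1)%R ->
  satisfies_rec p a b
    (conv2 (fun n => a ^ n * iqfac p n) (fun n => b ^ n * iqfac2 p n)).
Proof.
intros Hp N.
set (f := fun n => a ^ n * iqfac p n). set (g := fun n => b ^ n * iqfac2 p n).
assert (E : p ^ N * conv2 f g N =
  conv2 (fun n => 1 * f n + - a * shift 1 f n)
        (fun n => 1 * g n + - b * shift 1 g n) N).
{ rewrite <- conv2_weight. apply conv2_ext; intros n.
  - apply pow_weight_iqfac, Hp.
  - apply pow_weight_iqfac2, Hp. }
rewrite conv2_lin_l, !conv2_lin_r, !conv2_shift_r in E.
rewrite !conv2_shift_l in E.
replace (shift 2 (conv2 (shift 1 f) g) N) with (shift 3 (conv2 f g) N) in E.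
- replace ((1 - p ^ N) * conv2 f g N) with (conv2 f g N - p ^ N * conv2 f g N) by ring.
  rewrite E. ring.
- rewrite <- (shift_shift 2 1). apply shift_ext. intros _. symmetry. apply conv2_shift_l.
Qed.

(** Coefficients of [F(w) = (1 + a w) F(p w)] for [F(w) = (-a w; p)_oo]. *)
Lemma pow_weight_tri (p a : C) (n : nat) :
  (Cmod p < 1)%R ->
  p ^ tri n * a ^ n * iqfac p n =
  1 * (p ^ n * (p ^ tri n * a ^ n * iqfac p n)) +
  a * shift 1 (fun m => p ^ m * (p ^ tri m * a ^ m * iqfac p m)) n.
Proof.
intros Hp. destruct n as [|n].
- rewrite shift_lt by lia. simpl. ring.
- change (shift 1 (fun m => p ^ m * (p ^ tri m * a ^ m * iqfac p m)) (S n))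
    with (shift 1 (fun m => p ^ m * (p ^ tri m * a ^ m * iqfac p m)) (1 + n)).
  rewrite shift_add, <- (iqfac_S p n Hp). cbn [tri]. rewrite Cpow_add_r, !Cpow_S. ring.
Qed.

(** Coefficients of [G(p^2 w) = (1 - d w) (1 - d p w) G(w)] for [G(w) = 1 / (d w; p)_oo]. *)
Lemma pow2_weight_iqfac (p d : C) (n : nat) :
  (Cmod p < 1)%R ->
  p ^ (2 * n) * (d ^ n * iqfac p n) =
  1 * (1 * (d ^ n * iqfac p n) + - (d * (1 + p)) * shift 1 (fun m => d ^ m * iqfac p m) n)
  + d * d * p * shift 1 (shift 1 (fun m => d ^ m * iqfac p m)) n.
Proof.
intros Hp. rewrite shift_shift. destruct n as [|[|n]].
- rewrite !shift_lt by lia. simpl. ring.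
- rewrite (shift_lt (1 + 1)) by lia.
  change (shift 1 (fun m => d ^ m * iqfac p m) 1)
    with (shift 1 (fun m => d ^ m * iqfac p m) (1 + 0)).
  rewrite shift_add, <- (iqfac_S p 0 Hp). simpl. ring.
- pose proof (shift_add (1 + 1) (fun m => d ^ m * iqfac p m) n) as E2.
  pose proof (shift_add 1 (fun m => d ^ m * iqfac p m) (S n)) as E1.
  cbn [Nat.add] in E1, E2 |- *. rewrite E1, E2.
  rewrite <- (iqfac_S p n Hp), <- (iqfac_S p (S n) Hp).
  replace (2 * S (S n))%nat with (S (S n) + S (S n))%nat by lia.
  rewrite Cpow_add_r, !Cpow_S. ring.
Qed.

(** Put [R'(w) = F(p w) G(w^2)]. Then [X(w) = (1 + a w) R'(w)] and
    [X(p w) = (1 - d w^2) (1 - d p w^2) R'(w)]. The two hypotheses on [a, b, d] say that this last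
    product equals [(1 - a^2 w^2) (1 - b w^2)], whose factor [1 + a w] recombines with [R'] to
    [X]. *)
Lemma satisfies_rec_fermionic (p a b d : C) :
  (Cmod p < 1)%R -> a * a + b = d * (1 + p) -> a * a * b = d * d * p ->
  satisfies_rec p a b
    (conv2 (fun n => p ^ tri n * a ^ n * iqfac p n) (fun n => d ^ n * iqfac p n)).
Proof.
intros Hp H1 H2 N.
set (f := fun n => p ^ tri n * a ^ n * iqfac p n). set (g := fun n => d ^ n * iqfac p n).
set (f' := fun n => p ^ n * f n). set (R' := conv2 f' g).
assert (E : forall n, conv2 f g n = 1 * R' n + a * shift 1 R' n).
{ intros n. unfold R'. rewrite <- conv2_shift_l, <- conv2_lin_l.
  apply conv2_ext; [|reflexivity]. intros m. apply pow_weight_tri, Hp. }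
assert (P : p ^ N * conv2 f g N =
  R' N - d * (1 + p) * shift 2 R' N + d * d * p * shift 4 R' N).
{ rewrite <- conv2_weight.
  rewrite (conv2_ext _ f' _ (fun n => 1 * (1 * g n + - (d * (1 + p)) * shift 1 g n)
    + d * d * p * shift 1 (shift 1 g) n)).
  - rewrite (conv2_lin_r 1 (d * d * p)), conv2_lin_r, !conv2_shift_r.
    fold R'. replace (shift 2 (conv2 f' (shift 1 g)) N) with (shift 4 R' N); [ring|].
    rewrite <- (shift_shift 2 2). apply shift_ext. intros _. symmetry. apply conv2_shift_r.
  - reflexivity.
  - intros n. apply pow2_weight_iqfac, Hp. }
assert (S : forall k, shift k (conv2 f g) N = 1 * shift k R' N + a * shift (k + 1) R' N).
{ intros k. rewrite <- shift_shift, <- shift_lin. apply shift_ext. intros _. apply E. }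
replace ((1 - p ^ N) * conv2 f g N) with (conv2 f g N - p ^ N * conv2 f g N) by ring.
rewrite P, !S, (E N), <- H1, <- H2. simpl Nat.add. ring.
Qed.

(* Both sides are the coefficient of [w^N] in
   [1 / ((a w; p)_oo (b w^2; p^2)_oo) = (- a w; p)_oo / (d w^2; p)_oo]. *)
Lemma bosonic_fermionic (p a b d : C) (N : nat) :
  (Cmod p < 1)%R -> a * a + b = d * (1 + p) -> a * a * b = d * d * p ->
  conv2 (fun n => a ^ n * iqfac p n) (fun n => b ^ n * iqfac2 p n) N =
  conv2 (fun n => p ^ tri n * a ^ n * iqfac p n) (fun n => d ^ n * iqfac p n) N.
Proof.
intros Hp H1 H2. revert N. apply (satisfies_rec_unique p a b); trivial.
- apply satisfies_rec_bosonic, Hp.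
- apply satisfies_rec_fermionic; assumption.
- unfold conv2, iqfac2, iqfac, shift. simpl. field.
Qed.

(** * Euler's sum for [(-p; p)_oo] *)

(** Passing from [n] to [n+1] multiplies the quantity by [rho^n K], which is at most 1 from some [N]
    on. An initial segment therefore bounds everything. *)
Lemma pow_tri_bound (rho K : R) :
  (0 <= rho < 1)%R -> (0 <= K)%R ->
  exists M : R, (0 <= M)%R /\ forall n, (rho ^ tri n * K ^ n <= M)%R.
Proof.
intros Hr HK.
assert (Hpos : forall n, (0 <= rho ^ tri n * K ^ n)%R).
{ intros n. apply Rmult_le_pos; apply pow_le; lra. }
assert (Hfin : forall N, exists M, (0 <= M)%R /\
  forall n, (n <= N)%nat -> (rho ^ tri n * K ^ n <= M)%R).
{ induction N as [|N [M [HM IH]]].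
  - exists 1%R. split; [lra|]. intros n Hn. replace n with O by lia. simpl. lra.
  - exists (M + rho ^ tri (S N) * K ^ S N)%R. pose proof (Hpos (S N)).
    split; [lra|]. intros n Hn.
    destruct (Nat.eq_dec n (S N)) as [->|Hne]; [lra|].
    specialize (IH n ltac:(lia)). lra. }
destruct (pow_lt_1_zero rho ltac:(rewrite Rabs_pos_eq; lra) (/ (K + 1))) as [N HN].
{ apply Rinv_0_lt_compat. lra. }
destruct (Hfin N) as [M [HM HMN]]. exists M. split; [exact HM|]. intros n.
destruct (Nat.le_gt_cases n N) as [H|H]; [apply HMN, H|].
replace n with (N + (n - N))%nat by lia.
induction (n - N)%nat as [|m IH].
- rewrite Nat.add_0_r. apply HMN. lia.
- eapply Rle_trans; [|exact IH]. rewrite Nat.add_succ_r. cbn [tri].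
  rewrite pow_add. simpl (K ^ S _)%R.
  specialize (HN (N + m)%nat ltac:(lia)).
  rewrite Rabs_pos_eq in HN by (apply pow_le; lra).
  assert (rho ^ (N + m) * K <= 1)%R.
  { apply Rmult_lt_compat_r with (r := (K + 1)%R) in HN; [|lra].
    rewrite Rinv_l in HN by lra. pose proof (pow_le rho (N + m) ltac:(lra)). nra. }
  pose proof (Hpos (N + m)%nat). nra.
Qed.

(** Apply the previous bound to [8 K]. The ratio [/8] is [(/2)^3]: later reindexings spread the
    decay in one index over three. *)
Lemma pow_tri_decay (rho K : R) :
  (0 <= rho < 1)%R -> (0 <= K)%R ->
  exists M : R, (0 <= M)%R /\ forall n, (rho ^ tri n * K ^ n <= M * (/8) ^ n)%R.
Proof.
intros Hr HK. destruct (pow_tri_bound rho (8 * K) Hr ltac:(lra)) as [M [HM H]].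
exists M. split; [exact HM|]. intros n. specialize (H n).
rewrite Rpow_mult_distr in H.
pose proof (pow_lt (/8) n ltac:(lra)) as P.
apply Rmult_le_compat_r with (r := ((/8) ^ n)%R) in H; [|lra].
replace (rho ^ tri n * (8 ^ n * K ^ n) * (/8) ^ n)%R
  with (rho ^ tri n * K ^ n * (8 * /8) ^ n)%R in H
  by (rewrite Rpow_mult_distr; ring).
rewrite Rinv_r, pow1, Rmult_1_r in H by lra. exact H.
Qed.

(** Each factor satisfies [|1 - a p^k| >= 1 - |a|]. *)
Lemma Cmod_inv_qpoch_le (a p : C) (n : nat) :
  (Cmod a < 1)%R -> (Cmod p < 1)%R ->
  (Cmod (/ qpoch a p n) <= (/ (1 - Cmod a)) ^ n)%R.
Proof.
intros Ha Hp. pose proof (Cmod_ge_0 a). pose proof (Cmod_ge_0 p).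
induction n as [|n IH].
- simpl. replace (/ 1) with (RtoC 1) by field. rewrite Cmod_1. lra.
- assert (N1 : 1 - a * p ^ n <> 0) by (apply one_sub_neq0, Cmod_mult_pow_lt1; assumption).
  simpl qpoch. rewrite Cmod_inv by (apply Cmult_neq_0; [apply qpoch_neq0; assumption|exact N1]).
  rewrite Cmod_inv in IH by (apply qpoch_neq0; assumption).
  rewrite Cmod_mult, Rinv_mult. simpl pow. rewrite (Rmult_comm (/ (1 - Cmod a))).
  apply Rmult_le_compat.
  + left. apply Rinv_0_lt_compat, Cmod_gt_0, qpoch_neq0; assumption.
  + left. apply Rinv_0_lt_compat, Cmod_gt_0, N1.
  + exact IH.
  + apply Rinv_le_contravar; [lra|].
    pose proof (Cmod_triangle (1 - a * p ^ n) (a * p ^ n)) as T.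
    replace (1 - a * p ^ n + a * p ^ n) with (RtoC 1) in T by ring.
    rewrite Cmod_1, (Cmod_mult a), Cmod_pow in T.
    pose proof (pow_incr (Cmod p) 1 n ltac:(lra)) as T'. rewrite pow1 in T'.
    pose proof (pow_le (Cmod p) n ltac:(lra)). nra.
Qed.

Lemma Cmod_iqfac_le (p : C) (n : nat) :
  (Cmod p < 1)%R -> (Cmod (iqfac p n) <= (/ (1 - Cmod p)) ^ n)%R.
Proof. intros Hp. apply Cmod_inv_qpoch_le; assumption. Qed.

Lemma Cmod_pow_le1 (z : C) (n : nat) : (Cmod z <= 1)%R -> (Cmod (z ^ n) <= 1)%R.
Proof.
intros Hz. rewrite Cmod_pow. rewrite <- (pow1 n). apply pow_incr.
pose proof (Cmod_ge_0 z). lra.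
Qed.

Lemma pow_antitone (rho : R) (m n : nat) :
  (0 <= rho <= 1)%R -> (m <= n)%nat -> (rho ^ n <= rho ^ m)%R.
Proof.
intros Hr H. replace n with (m + (n - m))%nat by lia. rewrite pow_add.
pose proof (pow_incr rho 1 (n - m) Hr) as T. rewrite pow1 in T.
pose proof (pow_le rho m ltac:(lra)). pose proof (pow_le rho (n - m) ltac:(lra)). nra.
Qed.

Lemma tri_add (m n : nat) : tri (m + n) = (tri m + tri n + m * n)%nat.
Proof. induction m as [|m IH]; simpl; lia. Qed.

(** The term of index [r] in Euler's expansion of [(-p^(v+1); p)_oo], as [tri (S r) = tri r + r]. *)
Definition euler_term (p : C) (v r : nat) : C := p ^ (tri (S r) + r * v) * iqfac p r.

Definition euler_sum (p : C) (v : nat) : C := csum (euler_term p v).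

(** The bound is uniform in [v]: lowering the exponent to [tri r] only increases the modulus. *)
Lemma euler_term_dom (p : C) :
  (Cmod p < 1)%R -> exists M, (0 <= M)%R /\
  forall v r, (Cmod (euler_term p v r) <= M * (/8) ^ r)%R.
Proof.
intros Hp. pose proof (Cmod_ge_0 p).
assert (HK : (0 <= / (1 - Cmod p))%R) by (left; apply Rinv_0_lt_compat; lra).
destruct (pow_tri_decay (Cmod p) (/ (1 - Cmod p)) ltac:(lra) HK) as [M [HM B]].
exists M. split; [exact HM|]. intros v r. eapply Rle_trans; [|apply B].
unfold euler_term. rewrite Cmod_mult, Cmod_pow.
apply Rmult_le_compat.
- apply pow_le. lra.
- apply Cmod_ge_0.
- apply pow_antitone; [lra|]. simpl. lia.
- apply Cmod_iqfac_le, Hp.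
Qed.

Lemma pow_eighth (n : nat) : ((/8) ^ n = (/2) ^ n * (/2) ^ n * (/2) ^ n)%R.
Proof. rewrite <- !Rpow_mult_distr. f_equal. lra. Qed.

Lemma pow_half_bounds (n : nat) : (0 < (/2) ^ n <= 1)%R.
Proof.
split; [apply pow_lt; lra|]. rewrite <- (pow1 n). apply pow_incr. lra.
Qed.

Lemma pow_eighth_le (n : nat) : ((/8) ^ n <= (/2) ^ n)%R.
Proof. apply pow_incr. lra. Qed.

Lemma euler_term_geo_dom (p : C) :
  (Cmod p < 1)%R -> exists M, forall v, geo_dom M (euler_term p v).
Proof.
intros Hp. destruct (euler_term_dom p Hp) as [M [HM B]]. exists M. intros v r.
specialize (B v r). pose proof (pow_eighth_le r). nra.
Qed.

(** Subtracting the terms of index [r+1] for [v] and [v+1] produces a factor [1 - p^(r+1)]. It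
    cancels against [(p)_(r+1)] and leaves [p^(v+1)] times the term of index [r] for [v+1]. *)
Lemma euler_sum_step (p : C) (v : nat) :
  (Cmod p < 1)%R -> euler_sum p v = (1 + p ^ S v) * euler_sum p (S v).
Proof.
intros Hp. destruct (euler_term_geo_dom p Hp) as [M B].
set (w := fun r => euler_term p v r + -(1) * euler_term p (S v) r).
assert (W0 : w O = 0).
{ unfold w, euler_term. simpl. ring. }
assert (WS : forall r, w (S r) = p ^ S v * euler_term p (S v) r).
{ intros r. unfold w, euler_term. rewrite <- (iqfac_S p r Hp).
  replace (tri (S (S r)) + S r * S v)%nat
    with ((tri (S (S r)) + S r * v) + S r)%nat by lia.
  replace (tri (S (S r)) + S r * v)%nat with (S v + (tri (S r) + r * S v))%nat
    by (simpl; lia).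
  rewrite !Cpow_add_r. ring. }
assert (B2 : geo_dom M (fun r => -(1) * euler_term p (S v) r)).
{ intros r. rewrite Cmod_mult, Cmod_m1, Rmult_1_l. apply B. }
assert (E : csum w = euler_sum p v + -(1) * euler_sum p (S v)).
{ unfold w. rewrite (csum_plus M M _ _ (B v) B2), (csum_scal M _ _ (B (S v))).
  reflexivity. }
assert (E' : csum w = p ^ S v * euler_sum p (S v)).
{ rewrite (csum_head (M + M) w).
  - rewrite W0, (csum_ext _ _ WS), (csum_scal M _ _ (B (S v))).
    unfold euler_sum. ring.
  - intros r. eapply Rle_trans; [apply Cmod_triangle|].
    specialize (B v r). specialize (B2 r). simpl in B2. lra. }
rewrite E in E'.
replace (euler_sum p v) with (euler_sum p v + -(1) * euler_sum p (S v) + euler_sum p (S v))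
  by ring.
rewrite E'. ring.
Qed.

Lemma euler_sum_qpoch (p : C) (v : nat) :
  (Cmod p < 1)%R -> qpoch (- p) p v * euler_sum p v = euler_sum p 0.
Proof.
intros Hp. induction v as [|v IH]; [simpl; ring|].
rewrite <- IH, (euler_sum_step p v Hp). simpl. ring.
Qed.

(** The term of index 0 is 1 and all others contain a factor [p^v]. *)
Lemma euler_sum_tends_to (p : C) :
  (Cmod p < 1)%R -> tends_to (euler_sum p) 1.
Proof.
intros Hp. destruct (euler_term_geo_dom p Hp) as [M B].
pose proof (Cmod_ge_0 p) as Hp0.
apply (tends_to_squeeze _ _ (2 * M) (Cmod p)); [lra|]. intros v.
unfold euler_sum. rewrite (csum_head M _ (B v)).
replace (euler_term p v 0) with (RtoC 1)
  by (unfold euler_term; rewrite iqfac_0; simpl; ring).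
replace (1 + csum (fun n => euler_term p v (S n)) - 1)
  with (csum (fun n => euler_term p v (S n))) by ring.
replace (2 * M * Cmod p ^ v)%R with (2 * (M * Cmod p ^ v))%R by ring.
apply csum_bound. intros r.
replace (euler_term p v (S r)) with (p ^ v * (p ^ (r * v) * euler_term p 0 (S r))).
- rewrite !Cmod_mult, Cmod_pow.
  pose proof (Cmod_pow_le1 p (r * v) ltac:(lra)).
  pose proof (B O (S r)) as T. simpl in T.
  pose proof (Cmod_ge_0 (euler_term p 0 (S r))).
  pose proof (Cmod_ge_0 (p ^ (r * v))).
  pose proof (pow_le (Cmod p) v Hp0).
  pose proof (geo_dom_nonneg _ _ (B O)).
  pose proof (pow_half_bounds r).
  assert (Cmod (p ^ (r * v)) * Cmod (euler_term p 0 (S r)) <= M * (/2) ^ r)%R by nra.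
  nra.
- unfold euler_term. rewrite Nat.mul_0_r, Nat.add_0_r.
  replace (tri (S (S r)) + S r * v)%nat with (v + (r * v + tri (S (S r))))%nat by lia.
  rewrite !Cpow_add_r. ring.
Qed.

(** With [P] the finite product and [s = euler_sum p n], the product [P s] is the constant
    [euler_sum p 0] and [s] tends to 1, so [P] tends to that constant. *)
Lemma qpoch_inf_euler (p : C) :
  (Cmod p < 1)%R -> qpoch_inf (- p) p = euler_sum p 0.
Proof.
intros Hp. apply lim_tends_to. intros eps He.
pose proof (euler_sum_tends_to p Hp) as T.
(* Beyond [N1], [|s| > 1/2], hence [|P| <= 2 |P s|]; this explains the constant in the choice of
   [N2]. *)
destruct (T (/2)%R ltac:(lra)) as [N1 H1].
pose proof (Cmod_ge_0 (euler_sum p 0)) as Hc.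
destruct (T (eps / (2 * Cmod (euler_sum p 0) + 1))%R) as [N2 H2].
{ apply Rdiv_lt_0_compat; lra. }
exists (N1 + N2)%nat. intros n Hn.
specialize (H1 n ltac:(lia)). specialize (H2 n ltac:(lia)).
pose proof (euler_sum_qpoch p n Hp) as E.
set (P := qpoch (- p) p n) in *. set (s := euler_sum p n) in *.
rewrite <- E in H2 |- *. rewrite Cmod_mult in H2.
replace (P - P * s) with (- P * (s - 1)) by ring.
rewrite Cmod_mult, Cmod_opp.
apply Rmult_lt_compat_r with (r := (2 * (Cmod P * Cmod s) + 1)%R) in H2;
  [|pose proof (Cmod_ge_0 P); pose proof (Cmod_ge_0 s); nra].
unfold Rdiv in H2. rewrite Rmult_assoc, Rinv_l, Rmult_1_r in H2
  by (pose proof (Cmod_ge_0 P); pose proof (Cmod_ge_0 s); nra).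
eapply Rle_lt_trans; [|exact H2].
pose proof (Cmod_triangle (1 - s) s) as T1.
replace (1 - s + s) with (RtoC 1) in T1 by ring. rewrite Cmod_1 in T1.
rewrite <- (Cmod_opp (1 - s)) in T1.
replace (- (1 - s)) with (s - 1) in T1 by ring.
pose proof (Cmod_ge_0 P). pose proof (Cmod_ge_0 (s - 1)).
assert (Cmod P <= 2 * (Cmod P * Cmod s))%R by nra. nra.
Qed.

(** * Regrouping the double sums *)

(** Since [tri (u + 2v) >= tri u + tri v], the bound splits into two one-variable bounds. *)
Lemma pow_tri_twist_dom (q : C) (f g : nat -> C) (K : R) :
  (Cmod q < 1)%R -> (0 <= K)%R ->
  (forall n, (Cmod (f n) <= K ^ n)%R) -> (forall n, (Cmod (g n) <= K ^ n)%R) ->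
  exists M, (0 <= M)%R /\
  forall u v, (Cmod (q ^ tri (u + 2 * v) * (f u * g v)) <= M * (/8) ^ u * (/8) ^ v)%R.
Proof.
intros Hq HK Hf Hg. pose proof (Cmod_ge_0 q) as Hq0.
destruct (pow_tri_decay (Cmod q) K ltac:(lra) HK) as [M [HM B]].
exists (M * M)%R. split; [nra|]. intros u v.
rewrite !Cmod_mult, Cmod_pow.
assert (T : (Cmod q ^ tri (u + 2 * v) <= Cmod q ^ tri u * Cmod q ^ tri v)%R).
{ rewrite <- pow_add. apply pow_antitone; [lra|]. 
  replace (2 * v)%nat with (v + v)%nat by lia. rewrite !tri_add. nia. }
pose proof (B u) as Bu. pose proof (B v) as Bv.
pose proof (pow_le (Cmod q) (tri u) Hq0). pose proof (pow_le (Cmod q) (tri v) Hq0).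
pose proof (pow_le K u HK). pose proof (pow_le K v HK).
apply Rle_trans with ((Cmod q ^ tri u * Cmod q ^ tri v) * (K ^ u * K ^ v))%R.
- apply Rmult_le_compat; trivial.
  + apply pow_le. exact Hq0.
  + apply Rmult_le_pos; apply Cmod_ge_0.
  + apply Rmult_le_compat; trivial; apply Cmod_ge_0.
- replace (Cmod q ^ tri u * Cmod q ^ tri v * (K ^ u * K ^ v))%R
    with ((Cmod q ^ tri u * K ^ u) * (Cmod q ^ tri v * K ^ v))%R by ring.
  replace (M * M * (/8) ^ u * (/8) ^ v)%R with ((M * (/8) ^ u) * (M * (/8) ^ v))%R by ring.
  apply Rmult_le_compat; trivial; apply Rmult_le_pos; trivial.
Qed.

(** Put [v] outermost, shift the inner sum by [2 v] so that it runs over [N = u + 2 v], and swap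
    again. The factor [8^-v] pays for the outer [2^-v] and for the [2^(-2v)] inside [2^-N]. *)
Lemma csum_regroup (M : R) (q : C) (f g : nat -> C) :
  (0 <= M)%R ->
  (forall u v, (Cmod (q ^ tri (u + 2 * v) * (f u * g v)) <= M * (/8) ^ u * (/8) ^ v)%R) ->
  csum (fun u => csum (fun v => q ^ tri (u + 2 * v) * (f u * g v))) =
  csum (fun N => q ^ tri N * conv2 f g N).
Proof.
intros HM B.
set (F := fun v u => q ^ tri (u + 2 * v) * (f u * g v)).
assert (BF : geo_dom2 M F).
{ intros v u. eapply Rle_trans; [apply B|].
  pose proof (pow_eighth_le u). pose proof (pow_eighth_le v).
  pose proof (pow_half_bounds u). pose proof (pow_half_bounds v).
  pose proof (pow_lt (/8) u ltac:(lra)). pose proof (pow_lt (/8) v ltac:(lra)).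
  rewrite !Rmult_assoc. apply Rmult_le_compat_l; [exact HM|nra]. }
transitivity (csum (fun v => csum (F v))).
{ apply (csum_swap M (fun u v => F v u)), geo_dom2_swap, BF. }
transitivity (csum (fun v => csum (fun N => shift (2 * v) (F v) N))).
{ apply csum_ext. intros v. symmetry.
  apply (csum_shift (M * (/2) ^ v)), geo_dom2_row, BF. }
rewrite (csum_swap M).
- apply csum_ext. intros N.
  rewrite (csum_finite _ (S N)) by (intros v Hv; apply shift_lt; lia).
  unfold conv2. rewrite <- psum_scal. apply psum_ext. intros v _.
  unfold shift. destruct (Nat.leb_spec (2 * v) N) as [H|H]; [|ring].
  unfold F. replace (N - 2 * v + 2 * v)%nat with N by lia. ring.
- intros v N. destruct (Nat.le_gt_cases (2 * v) N) as [H|H].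
  + replace N with (2 * v + (N - 2 * v))%nat by lia. rewrite shift_add.
    set (u := (N - 2 * v)%nat). unfold F. eapply Rle_trans; [apply B|].
    replace (2 * v + u)%nat with (v + v + u)%nat by lia.
    rewrite !pow_add, (pow_eighth v).
    pose proof (pow_eighth_le u). pose proof (pow_half_bounds v).
    pose proof (pow_lt (/8) u ltac:(lra)).
    replace (M * (/8) ^ u * ((/2) ^ v * (/2) ^ v * (/2) ^ v))%R
      with ((M * ((/2) ^ v * (/2) ^ v * (/2) ^ v)) * (/8) ^ u)%R by ring.
    replace (M * (/2) ^ v * ((/2) ^ v * (/2) ^ v * (/2) ^ u))%R
      with ((M * ((/2) ^ v * (/2) ^ v * (/2) ^ v)) * (/2) ^ u)%R by ring.
    apply Rmult_le_compat_l; [|assumption].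
    repeat apply Rmult_le_pos; lra.
  + rewrite shift_lt by lia. rewrite Cmod_0.
    pose proof (pow_half_bounds v). pose proof (pow_half_bounds N).
    repeat apply Rmult_le_pos; lra.
Qed.

Lemma csum_shift_fun (k n : nat) (f : nat -> nat -> C) :
  csum (fun j => shift k (fun u => f u j) n) = shift k (fun u => csum (f u)) n.
Proof.
unfold shift. destruct (k <=? n)%nat; [reflexivity|].
apply (csum_finite (fun _ => 0) 0). reflexivity.
Qed.

(** The substitution [i = r + u], [j = r + v]: with [r] outermost, both shifts can be undone. The
    factor [8^-r] pays for [2^-r] in each of the three summation indices. *)
Lemma csum_diagonal_shift (M : R) (T : nat -> nat -> nat -> C) :
  (0 <= M)%R ->
  (forall r u v, (Cmod (T r u v) <= M * (/8) ^ r * (/8) ^ u * (/8) ^ v)%R) ->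
  csum (fun i => csum (fun j => csum (fun r =>
    shift r (fun u => shift r (T r u) j) i))) =
  csum (fun u => csum (fun v => csum (fun r => T r u v))).
Proof.
intros HM B.
assert (BT : geo_dom3 M T).
{ intros r u v. eapply Rle_trans; [apply B|].
  pose proof (pow_eighth_le u). pose proof (pow_eighth_le v). pose proof (pow_eighth_le r).
  pose proof (pow_lt (/8) u ltac:(lra)). pose proof (pow_lt (/8) v ltac:(lra)).
  pose proof (pow_lt (/8) r ltac:(lra)).
  repeat apply Rmult_le_compat; trivial; try lra;
    repeat apply Rmult_le_pos; lra. }
rewrite (csum_rotate M), (csum_rotate M (fun u v r => T r u v)).
- apply csum_ext. intros r.
  transitivity (csum (fun i => shift r (fun u => csum (T r u)) i)).
  + apply csum_ext. intros i. rewrite csum_shift_fun.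
    apply shift_ext. intros _. apply (csum_shift (M * (/2) ^ r * (/2) ^ (i - r))).
    intros v. apply BT.
  + apply (csum_shift (2 * (M * (/2) ^ r))), geo_dom2_csum. intros u v. apply BT.
- intros u v r. specialize (BT r u v). lra.
- intros i j r.
  pose proof (pow_half_bounds i). pose proof (pow_half_bounds j).
  pose proof (pow_half_bounds r).
  assert (P : (0 <= M * (/2) ^ i * (/2) ^ j * (/2) ^ r)%R)
    by (repeat apply Rmult_le_pos; lra).
  destruct (Nat.le_gt_cases r i) as [Hi|Hi]; [|rewrite shift_lt, Cmod_0 by lia; exact P].
  destruct (Nat.le_gt_cases r j) as [Hj|Hj].
  + replace i with (r + (i - r))%nat by lia. rewrite shift_add.
    replace j with (r + (j - r))%nat by lia. rewrite shift_add.
    set (u := (i - r)%nat). set (v := (j - r)%nat).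
    eapply Rle_trans; [apply B|]. rewrite !pow_add, (pow_eighth r).
    pose proof (pow_eighth_le u). pose proof (pow_eighth_le v).
    pose proof (pow_lt (/8) u ltac:(lra)). pose proof (pow_lt (/8) v ltac:(lra)).
    set (c := (M * ((/2) ^ r * (/2) ^ r * (/2) ^ r))%R).
    replace (M * ((/2) ^ r * (/2) ^ u) * ((/2) ^ r * (/2) ^ v) * (/2) ^ r)%R
      with (c * ((/2) ^ u * (/2) ^ v))%R by (unfold c; ring).
    rewrite (Rmult_assoc c). apply Rmult_le_compat_l.
    * unfold c. repeat apply Rmult_le_pos; lra.
    * apply Rmult_le_compat; lra.
  + unfold shift at 1. destruct (r <=? i)%nat; [rewrite shift_lt by lia|];
      rewrite Cmod_0; exact P.
Qed.

(** * The transformation of double sums *)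

Lemma Cmod_scaled_iqfac_le (p a : C) (n : nat) :
  (Cmod p < 1)%R -> (Cmod a <= 1)%R ->
  (Cmod (a ^ n * iqfac p n) <= (/ (1 - Cmod p)) ^ n)%R.
Proof.
intros Hp Ha. rewrite Cmod_mult.
pose proof (Cmod_pow_le1 a n Ha). pose proof (Cmod_iqfac_le p n Hp).
pose proof (Cmod_ge_0 (a ^ n)). pose proof (Cmod_ge_0 (iqfac p n)). nra.
Qed.

Lemma euler_sum_eq (p : C) (v : nat) :
  (Cmod p < 1)%R -> euler_sum p v = qpoch_inf (- p) p * / qpoch (- p) p v.
Proof.
intros Hp. rewrite (qpoch_inf_euler p Hp), <- (euler_sum_qpoch p v Hp).
field. apply qpoch_neq0; [rewrite Cmod_opp|]; exact Hp.
Qed.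

(** One statement for both identities. The exponent hypothesis on [E] carries the Durfee factor
    [p^(u v)], so [E] is used only through [r, u, v], and all domination is proved for the triple
    sum. *)
Lemma double_sum_transform (q p a b d : C) (E : nat -> nat -> C) :
  (Cmod q < 1)%R -> (Cmod p < 1)%R ->
  (Cmod a <= 1)%R -> (Cmod b <= 1)%R -> (Cmod d <= 1)%R ->
  a * a + b = d * (1 + p) -> a * a * b = d * d * p ->
  (forall r u v, E (r + u)%nat (r + v)%nat * p ^ (u * v) =
     q ^ tri (u + 2 * v) * a ^ u * b ^ v * p ^ (tri (S r) + r * v)) ->
  dsum (fun i j => E i j / (qpoch p p i * qpoch p p j)) =
  qpoch_inf (- p) p *
  dsum (fun i j => q ^ tri (i + 2 * j) * p ^ tri i * a ^ i * d ^ j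
                   / (qpoch p p i * qpoch p p j)).
Proof.
intros Hq Hp Ha Hb Hd H1 H2 HE. unfold dsum.
set (K := (/ (1 - Cmod p))%R).
assert (HK : (1 <= K)%R).
{ unfold K. rewrite <- Rinv_1. pose proof (Cmod_ge_0 p).
  apply Rinv_le_contravar; lra. }
assert (HKpow : forall n, (1 <= K ^ n)%R) by (intros; apply pow_R1_Rle, HK).
set (f := fun n => a ^ n * iqfac p n). set (g := fun n => b ^ n * iqfac p n).
set (g2 := fun n => b ^ n * iqfac2 p n).
set (f3 := fun n => p ^ tri n * a ^ n * iqfac p n). set (g3 := fun n => d ^ n * iqfac p n).
assert (Bf : forall n, (Cmod (f n) <= K ^ n)%R)
  by (intros; apply Cmod_scaled_iqfac_le; assumption).
assert (Bg : forall n, (Cmod (g n) <= K ^ n)%R)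
  by (intros; apply Cmod_scaled_iqfac_le; assumption).
assert (Bg3 : forall n, (Cmod (g3 n) <= K ^ n)%R)
  by (intros; apply Cmod_scaled_iqfac_le; assumption).
assert (Bf3 : forall n, (Cmod (f3 n) <= K ^ n)%R).
{ intros n. unfold f3. rewrite <- Cmult_assoc, Cmod_mult.
  pose proof (Cmod_pow_le1 p (tri n) ltac:(lra)).
  pose proof (Bf n). fold (f n). pose proof (Cmod_ge_0 (f n)).
  pose proof (Cmod_ge_0 (p ^ tri n)). nra. }
assert (Bg2 : forall n, (Cmod (g2 n) <= (K * K) ^ n)%R).
{ intros n. unfold g2, iqfac2. rewrite Rpow_mult_distr.
  replace (b ^ n * / (qpoch p p n * qpoch (- p) p n))
    with (g n * / qpoch (- p) p n).
  - rewrite Cmod_mult. apply Rmult_le_compat; try apply Cmod_ge_0; [apply Bg|].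
    unfold K. rewrite <- (Cmod_opp p). apply Cmod_inv_qpoch_le; [rewrite Cmod_opp|]; exact Hp.
  - unfold g, iqfac. field. split; apply qpoch_neq0; try rewrite Cmod_opp; exact Hp. }
destruct (pow_tri_twist_dom q f g K Hq ltac:(lra) Bf Bg) as [M1 [HM1 D1]].
destruct (euler_term_dom p Hp) as [M2 [HM2 D2]].
set (T := fun r u v => q ^ tri (u + 2 * v) * (f u * g v) * euler_term p v r).
assert (DT : forall r u v, (Cmod (T r u v) <= (M1 * M2) * (/8) ^ r * (/8) ^ u * (/8) ^ v)%R).
{ intros r u v. unfold T. rewrite Cmod_mult.
  replace (M1 * M2 * (/8) ^ r * (/8) ^ u * (/8) ^ v)%R
    with ((M1 * (/8) ^ u * (/8) ^ v) * (M2 * (/8) ^ r))%R by ring.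
  apply Rmult_le_compat; try apply Cmod_ge_0; auto. }
transitivity (csum (fun u => csum (fun v => csum (fun r => T r u v)))).
{ rewrite <- (csum_diagonal_shift (M1 * M2) T) by (trivial; nra).
  apply csum_ext. intros i. apply csum_ext. intros j.
  (* Terms with [r > i] vanish, so the sum over [r] is the finite Durfee sum. *)
  rewrite (csum_finite _ (S i)) by (intros r Hr; apply shift_lt; lia).
  transitivity (E i j * (iqfac p i * iqfac p j)).
  { unfold iqfac. field. split; apply qpoch_neq0; exact Hp. }
  rewrite <- durfee_rectangle, <- psum_scal by exact Hp. apply psum_ext. intros r Hr.
  unfold durfee_term.
  destruct (Nat.le_gt_cases r j) as [Hj|Hj].
  - pose proof (HE r (i - r)%nat (j - r)%nat) as HEr.
    replace (r + (i - r))%nat with i in HEr by lia.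
    replace (r + (j - r))%nat with j in HEr by lia.
    unfold shift. destruct (Nat.leb_spec r i); [|lia]. destruct (Nat.leb_spec r j); [|lia].
    unfold T, f, g, euler_term.
    transitivity ((E i j * p ^ ((i - r) * (j - r))) *
      (iqfac p r * iqfac p (i - r) * iqfac p (j - r))); [ring|].
    rewrite HEr. ring.
  - unfold shift. destruct (Nat.leb_spec r i); [|lia]. destruct (Nat.leb_spec r j); [lia|].
    ring. }
(* [g2] has the extra factor [1 / (-p; p)_v], bounded by a second [K^v]. *)
destruct (pow_tri_twist_dom q f g2 (K * K) Hq ltac:(nra)) as [M3 [HM3 D3]].
{ intros n. eapply Rle_trans; [apply Bf|]. apply pow_incr. nra. }
{ exact Bg2. }
destruct (pow_tri_twist_dom q f3 g3 K Hq ltac:(lra) Bf3 Bg3) as [M4 [HM4 D4]].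
transitivity (qpoch_inf (- p) p *
  csum (fun u => csum (fun v => q ^ tri (u + 2 * v) * (f u * g2 v)))).
{ assert (G3 : geo_dom2 M3 (fun u v => q ^ tri (u + 2 * v) * (f u * g2 v))).
  { intros u v. eapply Rle_trans; [apply D3|].
    pose proof (pow_eighth_le u). pose proof (pow_eighth_le v).
    pose proof (pow_lt (/8) u ltac:(lra)). pose proof (pow_lt (/8) v ltac:(lra)).
    repeat apply Rmult_le_compat; trivial; try lra; repeat apply Rmult_le_pos; lra. }
  rewrite <- (csum_scal (2 * M3)) by (apply (geo_dom2_csum M3 _ G3)).
  apply csum_ext. intros u.
  rewrite <- (csum_scal (M3 * (/2) ^ u)) by (apply (geo_dom2_row M3 _ u G3)).
  apply csum_ext. intros v.
  destruct (euler_term_geo_dom p Hp) as [M5 D5].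
  unfold T. rewrite (csum_scal M5 _ _ (D5 v)).
  change (csum (euler_term p v)) with (euler_sum p v). rewrite (euler_sum_eq p v Hp).
  unfold g, g2, iqfac, iqfac2. field.
  split; apply qpoch_neq0; try rewrite Cmod_opp; exact Hp. }
(* Collect by [N], exchange the coefficient, and expand again with [f3] and [g3]. *)
f_equal. rewrite (csum_regroup M3 q f g2 HM3 D3).
transitivity (csum (fun N => q ^ tri N * conv2 f3 g3 N)).
{ apply csum_ext. intros N. f_equal. apply bosonic_fermionic; assumption. }
rewrite <- (csum_regroup M4 q f3 g3 HM4 D4).
apply csum_ext. intros u. apply csum_ext. intros v.
unfold f3, g3, iqfac. field. split; apply qpoch_neq0; exact Hp.
Qed.

(** * Integer exponents and the two specialisations *)

Lemma tri_Z (n : nat) : (2 * Z.of_nat (tri n) = Z.of_nat n * (Z.of_nat n - 1))%Z.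
Proof. induction n as [|n IH]; [reflexivity|]. simpl tri. nia. Qed.

Lemma cpowZ_nat (q : C) (z : Z) (n : nat) : z = Z.of_nat n -> cpowZ q z = q ^ n.
Proof.
intros ->. unfold cpowZ. destruct (Z.leb_spec 0 (Z.of_nat n)); [|lia].
rewrite Nat2Z.id. reflexivity.
Qed.

(** With [z >= 0] no inverse of [q] occurs, so [q = 0] is covered. *)
Lemma cpowZ_mul_pow (q : C) (z : Z) (m n : nat) :
  (0 <= z)%Z -> (z + Z.of_nat m = Z.of_nat n)%Z -> cpowZ q z * q ^ m = q ^ n.
Proof.
intros Hz H. rewrite (cpowZ_nat q z (Z.to_nat z)) by lia.
rewrite <- Cpow_add_r. f_equal. lia.
Qed.

Lemma div2_eq (x y : Z) : (x = 2 * y -> x / 2 = y)%Z.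
Proof. intros ->. rewrite Z.mul_comm. apply Z.div_mul. lia. Qed.

Lemma mul_pred_nonneg (m : Z) : (0 <= m * (m - 1))%Z.
Proof. nia. Qed.

Theorem theorem1p2 (q : C) (hq : (Cmod q < 1)%R) :
  S1 q = qpoch_inf (- q ^ 3) (q ^ 3) * S3 q /\
  S2 q = qpoch_inf (- q ^ 3) (q ^ 3) * S4 q.
Proof.
pose proof (Cmod_ge_0 q) as Hq0.
assert (Hp : (Cmod (q ^ 3) < 1)%R) by (apply (Cmod_mult_pow_lt1 q q 2); assumption).
assert (L : forall n, (Cmod (q ^ n) <= 1)%R) by (intros n; apply Cmod_pow_le1; lra).
assert (L1 : (Cmod 1 <= 1)%R) by (rewrite Cmod_1; lra).
split; unfold S1, S2, S3, S4, Sgen.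
(* Here [a^2 = d] and [b = d p]. *)
- rewrite (double_sum_transform q (q ^ 3) 1 (q ^ 3) 1); try assumption; try apply L.
  + f_equal. unfold dsum. apply csum_ext. intros i. apply csum_ext. intros j.
    f_equal. rewrite !Cpow_1_l, <- Cpow_mult_r, !Cmult_1_r, <- Cpow_add_r.
    symmetry. apply cpowZ_nat. unfold e3.
    pose proof (tri_Z (i + 2 * j)) as A1. pose proof (tri_Z i) as A2.
    lia.
  + ring.
  + ring.
  + intros r u v.
    rewrite Cpow_1_l, Cmult_1_r, <- !Cpow_mult_r, <- !Cpow_add_r.
    pose proof (tri_Z (u + 2 * v)) as A1. pose proof (tri_Z (S r)) as A2.
    assert (V : e1 (Z.of_nat (r + u)) (Z.of_nat (r + v)) =
      (Z.of_nat (tri (u + 2 * v) + 3 * v + 3 * (tri (S r) + r * v)) - Z.of_nat (3 * (u * v)))%Z).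
    { unfold e1. apply div2_eq. lia. }
    apply cpowZ_mul_pow; rewrite V; [|lia].
    set (x := Z.of_nat u). set (y := Z.of_nat v). set (z := Z.of_nat r).
    pose proof (mul_pred_nonneg (x - y)) as N1.
    assert (N2 : (0 <= (z + y) * (z + y + 1))%Z) by (apply Z.mul_nonneg_nonneg; lia).
    (* Completing products of consecutive integers shows that the exponent is nonnegative. *)
    enough ((2 * (Z.of_nat (tri (u + 2 * v) + 3 * v + 3 * (tri (S r) + r * v))
      - Z.of_nat (3 * (u * v))) = (x - y) * (x - y - 1) + 3 * ((z + y) * (z + y + 1)))%Z) by lia.
    unfold x, y, z. lia.
(* Here the roles are exchanged: [a^2 = d p] and [b = d]. Writing [q ^ 1] lets [Cpow_mult_r] collect
   all powers of [q]. *)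
- rewrite (double_sum_transform q (q ^ 3) (q ^ 2) (q ^ 1) (q ^ 1)); try assumption; try apply L.
  + f_equal. unfold dsum. apply csum_ext. intros i. apply csum_ext. intros j.
    f_equal. rewrite <- !Cpow_mult_r, <- !Cpow_add_r.
    symmetry. apply cpowZ_nat. unfold e4.
    pose proof (tri_Z (i + 2 * j)) as A1. pose proof (tri_Z i) as A2.
    lia.
  + ring.
  + ring.
  + intros r u v.
    rewrite <- !Cpow_mult_r, <- !Cpow_add_r.
    pose proof (tri_Z (u + 2 * v)) as A1. pose proof (tri_Z (S r)) as A2.
    assert (V : e2 (Z.of_nat (r + u)) (Z.of_nat (r + v)) =
      (Z.of_nat (tri (u + 2 * v) + 2 * u + 1 * v + 3 * (tri (S r) + r * v)) - Z.of_nat (3 * (u * v)))%Z).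
    { unfold e2. apply div2_eq. lia. }
    apply cpowZ_mul_pow; rewrite V; [|lia].
    set (x := Z.of_nat u). set (y := Z.of_nat v). set (z := Z.of_nat r).
    pose proof (Z.square_nonneg (x - y)) as N1. pose proof (Z.square_nonneg (z + y)) as N2.
    (* Nonnegativity again, now from two squares and the term [3 (u + r)]. *)
    enough ((2 * (Z.of_nat (tri (u + 2 * v) + 2 * u + 1 * v + 3 * (tri (S r) + r * v))
      - Z.of_nat (3 * (u * v))) =
      (x - y) * (x - y) + 3 * ((z + y) * (z + y)) + 3 * (x + z))%Z) by lia.
    unfold x, y, z. lia.
Qed.
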